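(* Let $(X,X_+)$ be a pre-ordered vector space, let $W=\overline{(X_+)}_{ru}$ be the $\tau_{ru}$-closure of $X_+$, let $A=W\cap -W$, and let $[W]=\{[x]\in X/A: x\in W\}$. Then $(X/A,[W])$ is an Archimedeanization of $(X,X_+)$.
   Context: All vector spaces are real. A non-empty subset $W$ of a vector space $X$ is a wedge if $W+W\subseteq W$ and $tW\subseteq W$ for all $t\ge 0$; a wedge $C$ is a cone if $C\cap -C=\{0\}$. A pre-ordered vector space (POVS) is a vector space $X$ together with a wedge $X_+$; write $x\le y$ iff $y-x\in X_+$. If $X_+$ is a cone, $X$ is an ordered vector space (OVS). A POVS $X$ is Archimedean if $y\le 0$ whenever there is $u\in X_+$ with $ny\le u$ for all $n\in\mathbb N$. A linear operator $T:X\to Y$ between POVSs is positive if $T(X_+)\subseteq Y_+$. In a POVS $X$, a sequence $(x_n)$ ru-converges to $x$ (written $x_n\xrightarrow{ru}x$) if for some $w\in X$ and some sequence of indices $(m_k)_k$ one has $\pm k(x_n-x)\le w$ for all $n\ge m_k$, for every $k\in\mathbb N$. The ru-topology $\tau_{ru}$ on $X$ is the topology whose closed sets are exactly the $S\subseteq X$ such that $S\ni x_n\xrightarrow{ru}x$ implies $x\in S$; $\overline{S}_{ru}$ is the $\tau_{ru}$-closure of $S$. Archimedeanization: for a POVS $X$, let $\mathcal C_{Arch}(X)$ be the category whose objects are pairs $\langle Y,\phi\rangle$ with $Y$ an Archimedean OVS and $\phi:X\to Y$ a positive linear operator, and whose morphisms $\langle Y_1,\phi_1\rangle\to\langle Y_2,\phi_2\rangle$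 are positive linear operators $T:Y_1\to Y_2$ with $T\circ\phi_1=\phi_2$. If $\langle Y_0,\phi_0\rangle$ is an initial object of $\mathcal C_{Arch}(X)$, then the OVS $Y_0$ is called an Archimedeanization of $X$. *)

(* Defs.v *)
From HB Require Import structures.
From mathcomp Require Import all_boot all_order all_algebra.
From mathcomp Require Import ring_quotient.
From mathcomp Require Import boolp classical_sets functions reals topology.

Set Implicit Arguments.
Unset Strict Implicit.
Unset Printing Implicit Defensive.

Import Order.TTheory GRing.Theory Num.Theory.

Local Open Scope classical_set_scope.
Local Open Scope ring_scope.
Local Open Scope quotient_scope.

Section Wedges.
Context {R : realType} {V : lmodType R}.

Definition is_wedge (C : set V) : Prop :=
  [/\ C !=set0,
      forall x y, C x -> C y -> C (x + y) &
      forall (t : R) x, 0 <= t -> C x -> C (t *: x)].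

Definition is_cone (C : set V) : Prop :=
  is_wedge C /\ C `&` [set x | C (- x)] = [set 0].

End Wedges.

HB.mixin Record Lmodule_isPOVS (R : realType) X of GRing.Lmodule R X := {
  pos : set X;
  pos_wedge : is_wedge pos
}.

#[short(type="povsType")]
HB.structure Definition POVS (R : realType) :=
  {X of Lmodule_isPOVS R X & GRing.Lmodule R X}.

Definition vle {R : realType} {X : povsType R} (x y : X) : Prop := pos (y - x).

Notation "x '<=+' y" := (vle x y) (at level 70, no associativity).

Section POVSDefs.
Context {R : realType}.

Definition is_OVS (X : povsType R) : Prop := is_cone (@pos R X).

(* n = 0 only says that u is positive, and k = 0 below that w is (which k = 1
   already forces), so it is immaterial whether the naturals start at 0 or 1 *)
Definition archimedean (X : povsType R) : Prop :=
  forall y : X, (exists2 u : X, pos u & forall n : nat, y *+ n <=+ u) ->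
    y <=+ 0.

Definition positive {X Y : povsType R} (T : X -> Y) : Prop :=
  forall x, pos x -> pos (T x).

Definition ru_cvg {X : povsType R} (u : nat -> X) (x : X) : Prop :=
  exists (w : X) (m : nat -> nat), forall k n, (m k <= n)%N ->
    (u n - x) *+ k <=+ w /\ - ((u n - x) *+ k) <=+ w.

Definition ru_closed {X : povsType R} (S : set X) : Prop :=
  forall (u : nat -> X) (x : X), (forall n, S (u n)) -> ru_cvg u x -> S x.

End POVSDefs.

Section POVSFacts.
Context {R : realType} {X : povsType R}.
Implicit Types (x y : X) (S : set X).

Lemma posD x y : pos x -> pos y -> pos (x + y).
Proof. by case: (@pos_wedge R X) => _ + _; apply. Qed.

Lemma posZ (t : R) x : 0 <= t -> pos x -> pos (t *: x).
Proof. by case: (@pos_wedge R X) => _ _; apply. Qed.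

Lemma ru_cvg_sub (u : nat -> X) x (f : nat -> nat) :
  (forall n, (n <= f n)%N) -> ru_cvg u x -> ru_cvg (u \o f) x.
Proof.
move=> fge [w [m H]]; exists w, m => k n mkn.
by apply: H; exact: leq_trans mkn (fge n).
Qed.

Lemma ru_closedU S1 S2 : ru_closed S1 -> ru_closed S2 -> ru_closed (S1 `|` S2).
Proof.
move=> c1 c2 u x Su ux.
have [inf1|/existsNP[N noS1]] :=
    pselect (forall N, exists n, (N <= n)%N /\ S1 (u n)).
  have /choice[f fP] := inf1.
  left; apply: (c1 (u \o f)) => [n|]; first by case: (fP n).
  by apply: ru_cvg_sub => // n; case: (fP n).
right; apply: (c2 (u \o addn N)) => [n|].
  have [S1n|//] := Su (N + n)%N.
  by exfalso; apply: noS1; exists (N + n)%N; rewrite leq_addr.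
by apply: ru_cvg_sub => // n; rewrite leq_addl.
Qed.

Lemma ru_cvgDr (u : nat -> X) x y :
  ru_cvg u x -> ru_cvg (fun n => y + u n) (y + x).
Proof.
by move=> [w [m H]]; exists w, m => k n /H; rewrite opprD addrACA subrr add0r.
Qed.

Lemma ru_cvgZ (u : nat -> X) x (t : R) :
  0 <= t -> ru_cvg u x -> ru_cvg (fun n => t *: u n) (t *: x).
Proof.
move=> t0 [w [m H]]; exists (t *: w), m => k n /H[H1 H2].
have -> : (t *: u n - t *: x) *+ k = t *: ((u n - x) *+ k).
  by rewrite -scalerBr scalerMnr.
have vZ z : z <=+ w -> t *: z <=+ t *: w.
  by move=> zw; rewrite /vle -scalerBr; exact: posZ.
by split; [exact: vZ | rewrite -scalerN; exact: vZ].
Qed.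

End POVSFacts.

(* X with the ru-topology; an alias, because the carrier of a particular POVS
   may already carry another topology *)
Definition ruspace {R : realType} (X : povsType R) : Type := X.

Section RuTopology.
Context {R : realType} (X : povsType R).

HB.instance Definition _ := Choice.on (ruspace X).

Definition ru_open (S : set (ruspace X)) : Prop := @ru_closed R X (~` S).

Lemma ru_openT : ru_open setT.
Proof. by move=> u x /(_ 0%N); rewrite setCT. Qed.

Lemma ru_openI : setI_closed ru_open.
Proof. by move=> A B; rewrite /ru_open setCI; exact: ru_closedU. Qed.

Lemma ru_open_bigU (I : Type) (f : I -> set (ruspace X)) :
  (forall i, ru_open (f i)) -> ru_open (\bigcup_i f i).
Proof.
move=> fo u x Su ux [i _ fix_]; apply: (fo i u x) => // n fun_.
by apply: (Su n); exists i.
Qed.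

HB.instance Definition _ := isOpenTopological.Build (ruspace X)
  ru_openT ru_openI ru_open_bigU.

Lemma ru_closedE (S : set (ruspace X)) : closed S <-> @ru_closed R X S.
Proof. by rewrite -openC /open /= /ru_open setCK. Qed.

Definition ru_closure (S : set X) : set X := @closure (ruspace X) S.

End RuTopology.

Section ArchimedeanQuotient.
Context {R : realType} (X : povsType R).
Implicit Types x y : X.

Definition Wpos : set X := ru_closure (@pos R X).

Definition Aker : set X := Wpos `&` [set x | Wpos (- x)].

Lemma ru_closureP (S : set X) x :
  ru_closure S x <-> forall C : set X, ru_closed C -> S `<=` C -> C x.
Proof.
rewrite /ru_closure closureE; split=> [H C cC SC|H C [cC SC]].
  by apply: H; split => //; apply/ru_closedE.
by apply: H => //; apply/ru_closedE.
Qed.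

Lemma Wpos_sub : @pos R X `<=` Wpos.
Proof. by apply: (@subset_closure (ruspace X)). Qed.

Lemma Wpos_wedge : is_wedge Wpos.
Proof.
have Wcl : ru_closed Wpos by apply/ru_closedE; exact: closed_closure.
have clD y : ru_closed [set z | Wpos (y + z)].
  by move=> u z Wu /(@ru_cvgDr _ _ _ _ y); exact: Wcl.
split.
- by have [[x px] _ _] := @pos_wedge R X; exists x; exact: Wpos_sub.
- have pW x y : pos x -> Wpos y -> Wpos (x + y).
    move=> px /ru_closureP/(_ _ (clD x)); apply=> z pz.
    by apply: Wpos_sub; exact: posD.
  move=> x y + Wy; rewrite addrC => /ru_closureP/(_ _ (clD y)); apply=> z pz /=.
  by rewrite addrC; exact: pW.
- move=> t x t0 /ru_closureP/(_ [set z | Wpos (t *: z)]); apply.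
    by move=> u z Wu /(ru_cvgZ t0); exact: Wcl.
  by move=> z pz; apply: Wpos_sub; exact: posZ.
Qed.

Definition Apred : {pred X} := [pred x | `[< Aker x >]].

Lemma Apred_submod : submod_closed Apred.
Proof.
have [[z Wz] WD WZ] := Wpos_wedge.
have AZ (t : R) x : Aker x -> Aker (t *: x).
  move=> [Wx WNx]; have [t0|/ltW t0] := leP 0 t.
    by split; rewrite /= -?scalerN; apply: WZ.
  rewrite -oppr_ge0 in t0; split; rewrite /= -?scaleNr; last exact: WZ.
  by rewrite -[t]opprK scaleNr -scalerN; exact: WZ.
have W0 : Wpos 0 by rewrite -(scale0r z); exact: WZ.
split=> [|t x y /asboolP/(AZ t)[Wx WNx] /asboolP[Wy WNy]]; apply/asboolP.
  by split; rewrite /= ?oppr0.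
by split; rewrite /= ?opprD; exact: WD.
Qed.

Fact Apred_zmod : zmod_closed Apred.
Proof. exact: GRing.submod_closedB Apred_submod. Qed.

HB.instance Definition _ := GRing.isZmodClosed.Build X Apred Apred_zmod.

Fact Apred_scaler : GRing.scaler_closed Apred.
Proof.
move=> a x Ax; have [A0 H] := Apred_submod.
by rewrite -[a *: x]addr0; exact: H.
Qed.

HB.instance Definition _ := GRing.isScaleClosed.Build R X Apred Apred_scaler.

(* X / A as a vector space; the wedge [W] is attached to it below *)
Definition archquot : Type := {ideal_quot Apred}.

HB.instance Definition _ := GRing.Zmodule.on archquot.

Definition archpi (x : X) : archquot := \pi_({ideal_quot Apred}) x.

Lemma archpi_eq x y : archpi x = archpi y <-> Aker (x - y).
Proof.
rewrite /archpi; split=> [/eqP|Axy].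
  by rewrite -Quotient.idealrBE => /asboolP.
by apply/eqP; rewrite -Quotient.idealrBE; apply/asboolP.
Qed.

Lemma archpiD x y : archpi (x + y) = archpi x + archpi y.
Proof. exact: (@Quotient.pi_add _ _ x y). Qed.

Lemma archpi_repr (q : archquot) : archpi (repr (q : {ideal_quot Apred})) = q.
Proof. exact: reprK. Qed.

Definition archscale (t : R) (q : archquot) : archquot :=
  archpi (t *: repr (q : {ideal_quot Apred})).

Lemma archscaleE t x : archscale t (archpi x) = archpi (t *: x).
Proof.
apply/archpi_eq; rewrite -scalerBr; apply/asboolP.
by apply: Apred_scaler; apply/asboolP/archpi_eq; rewrite archpi_repr.
Qed.

Lemma archscaleA a b q : archscale a (archscale b q) = archscale (a * b) q.
Proof. by rewrite -(archpi_repr q) !archscaleE scalerA. Qed.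

Lemma archscale1 : left_id 1 archscale.
Proof. by move=> q; rewrite -(archpi_repr q) archscaleE scale1r. Qed.

Lemma archscaleDr : right_distributive archscale +%R.
Proof.
move=> a p q; rewrite -(archpi_repr p) -(archpi_repr q).
by rewrite !(archscaleE, =^~ archpiD) scalerDr.
Qed.

Lemma archscaleDl q : {morph archscale^~ q : a b / a + b}.
Proof.
move=> a b /=; rewrite -(archpi_repr q).
by rewrite !(archscaleE, =^~ archpiD) scalerDl.
Qed.

HB.instance Definition _ := GRing.Zmodule_isLmodule.Build R archquot
  archscaleA archscale1 archscaleDr archscaleDl.

Definition Wclass : set archquot := [set archpi x | x in Wpos].

Lemma Wclass_wedge : is_wedge Wclass.
Proof.
have [[z Wz] WD WZ] := Wpos_wedge; split.
- by exists (archpi z); exists z.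
- move=> _ _ [x Wx <-] [y Wy <-]; exists (x + y); first exact: WD.
  exact: archpiD.
- move=> t _ t0 [x Wx <-]; exists (t *: x); first exact: WZ.
  by rewrite -archscaleE.
Qed.

HB.instance Definition _ := Lmodule_isPOVS.Build R archquot Wclass_wedge.

End ArchimedeanQuotient.

Arguments Wpos {R} X _.
Arguments Aker {R} X _.
Arguments Wclass {R} X _.
Arguments ru_closure {R} X _ _.

Section Archimedeanization.
Context {R : realType} (X : povsType R).

(* The category C_Arch(X); equality of arrows is pointwise equality of the
   underlying operators *)
Record arch_obj := ArchObj {
  obj_space : povsType R;
  obj_map : {linear X -> obj_space};
  obj_OVS : is_OVS obj_space;
  obj_arch : archimedean obj_space;
  obj_pos : positive obj_map
}.

Record arch_hom (O1 O2 : arch_obj) := ArchHom {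
  hom_fun : {linear obj_space O1 -> obj_space O2};
  hom_pos : positive hom_fun;
  hom_comm : forall x, hom_fun (obj_map O1 x) = obj_map O2 x
}.

Definition is_initial (O : arch_obj) : Prop :=
  forall O', exists T : arch_hom O O', forall T' : arch_hom O O',
    hom_fun T' =1 hom_fun T.

Definition is_archimedeanization (Y : povsType R) : Prop :=
  exists (phi : {linear X -> Y}) (cY : is_OVS Y) (aY : archimedean Y)
    (pphi : positive phi), is_initial (ArchObj cY aY pphi).

End Archimedeanization.

(* Main.v *)
From HB Require Import structures.
Require Import Defs.
From mathcomp Require Import all_boot all_order all_algebra reals.
From mathcomp Require Import ring_quotient boolp classical_sets.

(** Write [W] for the ru-closure of [X_+] and [A] for its lineality space.
    Since [A] is contained in [W], a class [[x]] is positive in [X/A] exactly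
    when [x] lies in [W]; hence [X/A] is ordered by a cone, and the two
    substantial points are the following.

    Archimedean property.  If [u] and all [u - n y] lie in [W], then the
    vectors [u/n - y], [n >= 1], lie in [W] and should ru-converge to [-y].
    This asks for [u/n] to ru-converge to [0], that is, for a [w] with
    [u <= w] and [- u <= w] in the order of [X_+], whereas [u] is only known to lie in the larger wedge [W].
    Such a [w] exists ([Wpos_bounded]) because the vectors that are bounded
    in this sense contain [X_+] and form an ru-closed set.

    Universality.  For a positive operator [phi] into an Archimedean space
    [Y], the preimage of [Y_+] is ru-closed: if [phi u_n >= 0] and
    [k (u_n - x) <= w] for all [n] large enough with respect to [k], then
    [k phi(-x) <= phi w] for every [k], so [phi(-x) <= 0].  Hence [phi] sends [W] into [Y_+], and, as [Y_+] is a cone, it kills [A] and factors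
    through the quotient.  The factorization is unique because the quotient
    map is onto. *)

Set Implicit Arguments.
Unset Strict Implicit.
Unset Printing Implicit Defensive.

Import Order.TTheory GRing.Theory Num.Theory.

Local Open Scope classical_set_scope.
Local Open Scope ring_scope.
Local Open Scope quotient_scope.

Section RuClosedSets.
Context {R : realType} {X : povsType R}.
Implicit Types u w x y : X.

Lemma vleD x1 y1 x2 y2 : x1 <=+ y1 -> x2 <=+ y2 -> x1 + x2 <=+ y1 + y2.
Proof. by rewrite /vle opprD addrACA; exact: posD. Qed.

Lemma vleZ (t : R) x y : 0 <= t -> x <=+ y -> t *: x <=+ t *: y.
Proof. by move=> t0; rewrite /vle -scalerBr; exact: posZ. Qed.

Lemma pos_bound w x : x <=+ w -> - x <=+ w -> pos w.
Proof.
move=> xw Nxw; have := posZ _ (vleD xw Nxw) => /(_ 2^-1).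
rewrite invr_ge0 ler0n subrr subr0 -mulr2n -scaler_nat scalerA.
by rewrite mulVf ?pnatr_eq0// scale1r; apply.
Qed.

(** Boundedness of a limit [x] only needs one late term [u_n]: add the bounds
    of [u_n] and of [u_n - x]. *)
Lemma ru_closed_bounded :
  ru_closed [set x : X | exists w, x <=+ w /\ - x <=+ w].
Proof.
move=> u x ub [w [m H]]; have [v [uv Nuv]] := ub (m 1%N).
have [uxw Nuxw] := H 1%N _ (leqnn _); rewrite !mulr1n in uxw Nuxw.
exists (v + w); split.
- by have := vleD uv Nuxw; rewrite opprB addrC subrK.
- by have := vleD Nuv uxw; rewrite addrA addNr add0r.
Qed.

(** The bound [w] of [u] also regulates the convergence: [k u / (n + 1)] is
    within [w] as soon as [n >= k]. *)
Lemma ru_cvg_harmonic u w : u <=+ w -> - u <=+ w ->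
  ru_cvg (fun n => n.+1%:R^-1 *: u) 0.
Proof.
move=> uw Nuw; exists w, id => k n kn; rewrite subr0.
have -> : (n.+1%:R^-1 *: u) *+ k = (k%:R / n.+1%:R) *: u.
  by rewrite -scaler_nat scalerA.
have t0 : 0 <= k%:R / n.+1%:R :> R by rewrite divr_ge0.
have t1 : k%:R / n.+1%:R <= 1 :> R.
  by rewrite ler_pdivrMr ?ltr0Sn// mul1r ler_nat leqW.
have tw : (k%:R / n.+1%:R) *: w <=+ w.
  rewrite /vle -[X in X - _]scale1r -scalerBl.
  by apply: posZ (pos_bound uw Nuw); rewrite subr_ge0.
have trans x y z : x <=+ y -> y <=+ z -> x <=+ z.
  by move=> xy yz; have := posD yz xy; rewrite addrA subrK.
by split; apply: trans tw; rewrite -?scalerN; exact: vleZ.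
Qed.

End RuClosedSets.

Section Quotient.
Context {R : realType} {X : povsType R}.
Implicit Types u w x y : X.

Lemma Wpos_ru_closed : ru_closed (Wpos X).
Proof.
move=> u x Wu ux; apply/ru_closureP => C cC posC.
apply: (cC _ _ _ ux) => n; have /ru_closureP := Wu n; exact.
Qed.

(** The witness for a positive [x] is [x] itself, as [-x <= x]. *)
Lemma Wpos_bounded x : Wpos X x -> exists w, x <=+ w /\ - x <=+ w.
Proof.
move=> /ru_closureP/(_ _ ru_closed_bounded); apply=> y py; exists y.
rewrite /vle subrr opprK; split; last exact: posD.
by rewrite -(scale0r y); exact: posZ.
Qed.

(** The Archimedean property of the quotient, read in [X]: [- y] is the
    ru-limit of the vectors [u / (n + 1) - y] of the ru-closed wedge [W]. *)
Lemma Wpos_archimedean u y :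
  Wpos X u -> (forall n, Wpos X (u - y *+ n)) -> Wpos X (- y).
Proof.
move=> Wu Wuy; have [w [uw Nuw]] := Wpos_bounded Wu.
have /(@ru_cvgDr _ _ _ _ (- y)) := ru_cvg_harmonic uw Nuw; rewrite addr0.
apply: Wpos_ru_closed => n /=.
have [_ _ WZ] := Wpos_wedge X.
have -> : - y + n.+1%:R^-1 *: u = n.+1%:R^-1 *: (u - y *+ n.+1).
  rewrite scalerBr -[y *+ _]scaler_nat scalerA mulVf ?pnatr_eq0//.
  by rewrite scale1r addrC.
by apply: WZ; rewrite ?invr_ge0.
Qed.

Fact archpi_linear : linear (@archpi R X).
Proof. by move=> a x y; rewrite archpiD -archscaleE. Qed.

HB.instance Definition _ :=
  GRing.isLinear.Build R X (archquot X) *:%R (@archpi R X) archpi_linear.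

(** Positivity of a class does not depend on the representative, because two
    representatives differ by an element of [A], which is contained in the
    wedge [W]. *)
Lemma pos_archpi x : pos (archpi x) <-> Wpos X x.
Proof.
split=> [[y Wy /archpi_eq[_ /= Wxy]]|Wx]; last by exists x.
have [_ WD _] := Wpos_wedge X.
by have := WD _ _ Wy Wxy; rewrite opprB addrC subrK.
Qed.

Lemma archpi_surj (q : archquot X) : exists x, archpi x = q.
Proof. by exists (repr (q : {ideal_quot @Apred R X})); exact: archpi_repr. Qed.

Lemma archquot_OVS : is_OVS (archquot X).
Proof.
split; first exact: pos_wedge.
apply/seteqP; split=> [q [/=]|_ ->]; last first.
  have W0 : pos (0 : archquot X).
    have [[q Wq] _ _] := @pos_wedge R (archquot X).
    by rewrite -(scale0r q); exact: posZ.
  by split; rewrite //= oppr0.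
have [x <-] := archpi_surj q; rewrite -raddfN => /pos_archpi Wx /pos_archpi WNx.
by rewrite /= -(raddf0 (@archpi R X)); apply/archpi_eq; rewrite subr0.
Qed.

Lemma archquot_archimedean : archimedean (archquot X).
Proof.
move=> q [p]; have [y <-] := archpi_surj q; have [u <-] := archpi_surj p.
move=> /pos_archpi Wu Wuy; rewrite /vle sub0r -raddfN; apply/pos_archpi.
apply: Wpos_archimedean Wu _ => n; apply/pos_archpi.
by rewrite raddfB raddfMn; exact: Wuy.
Qed.

Lemma archpi_positive : positive (@archpi R X).
Proof. by move=> x px; apply/pos_archpi; exact: Wpos_sub. Qed.

End Quotient.

Section Factorization.
Context {R : realType} {X : povsType R}.

(** For a limit [x] of vectors [u_n] with positive images, the multiples
    [k (- phi x)] are all bounded by [phi w], so the Archimedean property of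
    the target gives [- phi x <= 0]. *)
Lemma ru_closed_preimage_pos {Y : povsType R} (phi : {linear X -> Y}) :
  archimedean Y -> positive phi -> ru_closed (phi @^-1` pos).
Proof.
move=> aY pphi u x pu [w [m H]] /=.
suff: - phi x <=+ 0 by rewrite /vle sub0r opprK.
apply: aY; exists (phi w).
  by apply: pphi; have [] := H 0%N _ (leqnn _); rewrite /vle mulr0n subr0.
move=> k; have [/pphi] := H k _ (leqnn _) => pw _.
(* phi w + k phi x = phi (w - k (u_n - x)) + k phi u_n *)
have pku : pos (phi (u (m k)) *+ k).
  by rewrite -scaler_nat; apply: posZ; [rewrite ler0n|exact: pu].
have := posD pw pku.
by rewrite raddfB raddfMn raddfB mulrnBl opprB addrA addrNK /vle mulNrn opprK.
Qed.

Lemma Wpos_positive {Y : povsType R} (phi : {linear X -> Y}) x :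
  archimedean Y -> positive phi -> Wpos X x -> pos (phi x).
Proof.
move=> aY pphi /ru_closureP/(_ (phi @^-1` pos)); apply; last exact: pphi.
exact: ru_closed_preimage_pos.
Qed.

Context (O : arch_obj X).

Lemma obj_map_Aker x : Aker X x -> obj_map O x = 0.
Proof.
move=> [Wx WNx]; have aO := @obj_arch _ _ O; have pO := @obj_pos _ _ O.
have [_ cone] := @obj_OVS _ _ O; rewrite -[_ = 0]/([set 0] _) -cone.
by split; rewrite /= -?raddfN; exact: Wpos_positive.
Qed.

Definition archlift (q : archquot X) : obj_space O :=
  obj_map O (repr (q : {ideal_quot @Apred R X})).

Lemma archliftE x : archlift (archpi x) = obj_map O x.
Proof.
apply/eqP; rewrite -subr_eq0 /archlift -raddfB; apply/eqP/obj_map_Aker.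
by apply/archpi_eq; rewrite archpi_repr.
Qed.

Fact archlift_linear : linear archlift.
Proof.
move=> a p q; have [x <-] := archpi_surj p; have [y <-] := archpi_surj q.
by rewrite -linearP !archliftE linearP.
Qed.

HB.instance Definition _ :=
  GRing.isLinear.Build R (archquot X) (obj_space O) *:%R archlift
    archlift_linear.

Lemma archlift_positive : positive archlift.
Proof.
move=> q; have [x <-] := archpi_surj q => /pos_archpi Wx; rewrite archliftE.
by apply: Wpos_positive => //; [exact: obj_arch|exact: obj_pos].
Qed.

End Factorization.

Theorem theorem2p2 (R : realType) (X : povsType R) :
  is_archimedeanization X (archquot X).
Proof.
exists (@archpi R X), archquot_OVS, archquot_archimedean, archpi_positive => O.
exists (@ArchHom _ _ (ArchObj _ _ _) _ (@archlift R X O)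
  (@archlift_positive R X O) (@archliftE R X O)) => T q /=.
have [x <-] := archpi_surj q.
by rewrite archliftE; exact: (hom_comm T x).
Qed.
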